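(* Let $\mu>0$ and $k_0,k_1\in\mathbb{R}$ be fixed. There exists a constant $C>0$ such that for any $\mathbf{u}\in\mathcal{W}$, $$\|\mathbf{u}\|^2_{L^4(\Omega)}\le C\|\mathbf{u}\|_{L^2(\Omega)}\|\nabla\mathbf{u}\|_{L^2(\Omega)}.$$
   Context: $\Omega:=\mathbb{R}\times(0,1)\subset\mathbb{R}^2$; $\mathbf{n}$ is the unit outer normal and $\tau$ a unit tangent vector on $\partial\Omega$; $\mathbb{D}(\mathbf{v})=\frac12(\nabla\mathbf{v}+\nabla^T\mathbf{v})$. The slip coefficient $k$ on $\partial\Omega$ is given by $k(x,1)=k_1$, $k(x,0)=k_0$. Set $\mathbf{V}:=\{\mathbf{v}\in H^1(\Omega)^2:\nabla\cdot\mathbf{v}=0,\ \mathbf{v}\cdot\mathbf{n}=0\text{ on }\partial\Omega\}$ and $\mathcal{W}:=\{\mathbf{v}\in\mathbf{V}\cap H^2(\Omega)^2: 2\mu\mathbb{D}(\mathbf{v})\mathbf{n}\cdot\tau=k(x,y)\mathbf{v}\cdot\tau\text{ on }\partial\Omega\}$. *)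

(* Defs.v *)
From HB Require Import structures.
From mathcomp Require Import all_boot all_order all_algebra.
From mathcomp Require Import all_classical all_reals all_analysis.
Set Implicit Arguments.
Unset Strict Implicit.
Unset Printing Implicit Defensive.
Import Order.TTheory GRing.Theory Num.Theory.
Import numFieldNormedType.Exports.
Local Open Scope classical_set_scope.
Local Open Scope ring_scope.

Section strip.
Context {R : realType}.
Implicit Types (f : R * R -> R) (phi : R * R -> R) (b : bool).

Definition Omega : set (R * R) := [set q | 0 < q.2 < 1].

Definition leb2 := ((@lebesgue_measure R) \x (@lebesgue_measure R))%E.

Definition basis (i : 'I_2) : R * R := if i == 0 then (1, 0) else (0, 1).

Definition partial (i : 'I_2) phi : R * R -> R := fun q => 'D_(basis i) phi q.

Definition iter_partial (s : seq 'I_2) phi := foldr partial phi s.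

Definition smooth phi := forall s : seq 'I_2,
  continuous (iter_partial s phi) /\
  forall i q, derivable (iter_partial s phi) q (basis i).

Definition compactly_supported_in (A : set (R * R)) phi :=
  exists K, [/\ compact K, K `<=` A & forall q, ~ K q -> phi q = 0].

Definition test_function (A : set (R * R)) phi :=
  smooth phi /\ compactly_supported_in A phi.

(* The Euclidean norm of a vector, the Frobenius norm of a matrix; the library
   norm on matrices is instead the maximum of the absolute values. *)
Definition frobenius m n (A : 'M[R]_(m, n)) : R :=
  Num.sqrt (\sum_i \sum_j A i j ^+ 2).

(* Fields are total functions on the plane; only their restriction to the
   strip matters, so they are cut off by zero outside of it. *)
Definition LpO (p : R) f : \bar R := ('N[leb2]_(p%:E)[EFin \o (f \_ Omega)])%E.

Definition LpOM (p : R) m n (F : R * R -> 'M[R]_(m, n)) : \bar R :=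
  LpO p (fun q => frobenius (F q)).

Definition L2 f := measurable_fun Omega f /\ (LpO 2 f < +oo)%E.

Definition is_weak_partial (i : 'I_2) f (g : R * R -> R) := L2 g /\
  forall phi, test_function Omega phi ->
    \int[leb2]_(q in Omega) (f q * partial i phi q) =
    - \int[leb2]_(q in Omega) (g q * phi q).

(* A representative of the weak derivative, which is unique up to equality
   almost everywhere on the strip; 0 when there is no derivative in L^2. *)
Definition wpartial (i : 'I_2) f : R * R -> R :=
  xget (cst 0) [set g | is_weak_partial i f g].

Definition H1 f := L2 f /\ forall i, exists g, is_weak_partial i f g.

Definition H2 f := H1 f /\ forall i, H1 (wpartial i f).

Definition wgrad (v : R * R -> 'cV[R]_2) : R * R -> 'M[R]_2 :=
  fun q => \matrix_(i, j) wpartial j (fun q' => v q' i 0) q.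

Definition symmetric_part (A : 'M[R]_2) : 'M[R]_2 := 2^-1 *: (A + A^T).

Definition dot (x y : 'cV[R]_2) : R := \sum_i x i 0 * y i 0.

(* The two boundary lines are indexed by bool: y = 1 is true, y = 0 is false. *)
Definition height b : R := b%:R.

Definition normal b : 'cV[R]_2 :=
  \col_i (if i == 0 then 0 else if b then 1 else -1).

(* The choice of orientation is immaterial: the tangent enters the slip
   condition linearly on both sides. *)
Definition tangent : 'cV[R]_2 := \col_i (if i == 0 then 1 else 0).

(* g is the trace of f in H^1 on the line y = height b. The trace operator is
   the continuous extension to H^1, with values in L^2 of the boundary, of the
   restriction of smooth compactly supported functions on the closed strip;
   this is the graph of that extension. *)
Definition has_trace b f (g : R -> R) :=
  measurable_fun [set: R] g /\
  exists phi : nat -> R * R -> R,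
    [/\ forall n, test_function [set: R * R] (phi n),
        LpO 2 (fun q => phi n q - f q) @[n --> \oo] --> 0%E,
        forall i,
          LpO 2 (fun q => partial i (phi n) q - wpartial i f q) @[n --> \oo]
            --> 0%E
      & ('N[@lebesgue_measure R]_(2%:E)
          [EFin \o (fun x => phi n (x, height b) - g x)%R])%E @[n --> \oo]
            --> 0%E].

Definition has_traceM b m n (F : R * R -> 'M[R]_(m, n)) (G : R -> 'M[R]_(m, n)) :=
  forall i j, has_trace b (fun q => F q i j) (fun x => G x i j).

Definition V (v : R * R -> 'cV[R]_2) :=
  [/\ forall i, H1 (fun q => v q i 0),
      {ae leb2, forall q, Omega q -> \tr (wgrad v q) = 0}
    & forall b, exists2 g, has_traceM b v g &
        {ae (@lebesgue_measure R), forall x, dot (g x) (normal b) = 0}].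

Definition slip (k0 k1 : R) b : R := if b then k1 else k0.

Definition W (mu k0 k1 : R) (v : R * R -> 'cV[R]_2) :=
  [/\ V v,
      forall i, H2 (fun q => v q i 0)
    & forall b, exists g, exists G,
        [/\ has_traceM b v g,
            has_traceM b (wgrad v) G
          & {ae (@lebesgue_measure R), forall x,
              2 * mu * dot (symmetric_part (G x) *m normal b) tangent =
              slip k0 k1 b * dot (g x) tangent}]].

End strip.

(* Main.v *)
(* Write u = (u1, u2).  For smooth phi vanishing at infinity along the strip,
   phi(x,y)^2 <= int_R 2|phi phi_x| dx, and phi(x,y)^2 <= b(x)^2 + int_0^1 2|phi phi_y| dy
   for every b such that b(x) is a value of phi(x,.) on [0,1].  Multiplying and
   integrating gives |phi|_4^4 <= 4 |phi|_2^2 |phi_x|_2 |phi_y|_2 up to a term that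
   disappears if b tends to 0, and Fatou's lemma passes to the limit along the smooth
   approximants that come with the traces.  For u2 take b(x) = phi(x,0), whose limit
   is the vanishing normal trace.  For u1 take b(x) = int_0^1 phi(x,y) dy: as
   div u = 0 and u2 vanishes on both boundary lines, b' tends to 0 in L^2(R), hence
   b^2 <= 2 |b|_2 |b'|_2 tends to 0. *)
Require Import Defs.
From mathcomp Require Import all_boot all_order all_algebra.
From mathcomp Require Import all_classical all_reals all_analysis.
From mathcomp Require Import measurable_realfun ring lra.
Import Order.TTheory GRing.Theory Num.Theory.
Import numFieldNormedType.Exports.
Local Open Scope ring_scope.
Local Open Scope classical_set_scope.

(** For general H^1 fields on the strip the inequality is false: a profile [phi(x / L)] independent
    of [y] has |phi|_4^2 of order L^(1/2), while |phi|_2 |phi_x|_2 stays bounded as L grows. The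
    term with [b] therefore cannot be absorbed by norms; it has to vanish, and for u1 this is the
    statement that the flux through vertical sections is zero. The obstacle is that this flux is
    only accessible through approximants. The traces on the two lines come with unrelated sequences,
    so u2 has one sequence [psi] that is small at y = 0 and another, [psi'], that is small at y = 1,
    and neither is tied by a divergence equation to the sequence [phi] of u1. The interpolation (1 -
    y) psi + y psi' repairs this: it still converges to u2, is small on both lines, and its vertical
    derivative plus phi_x tends to 0 in L^2, although it never vanishes exactly. *)

Section plane.
Context {R : realType}.
Local Notation mu := (@lebesgue_measure R).

(** * Measurability in the plane and one-dimensional bounds on squares *)

Lemma open_measurable2 (U : set (R * R)) : open U -> measurable U.
Proof.
move=> oU.
(* The sigma-algebra is the product one, so an open set is written as a countable union of boxes. A
   box of radius below [e / 2] whose centre is closer to the point than that radius stays in the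
   ball of radius [e]. *)
pose box (a : rat * rat * nat) : set (R * R) :=
  ball (ratr a.1.1 : R) a.2.+1%:R^-1 `*` ball (ratr a.1.2 : R) a.2.+1%:R^-1.
have -> : U = \bigcup_a (if `[< box a `<=` U >] then box a else set0).
  apply/seteqP; split=> [[x y] Uxy|q [a _]]; last first.
    by case: ifPn => // /asboolP aU; apply: aU.
  move: (oU); rewrite openE => /(_ _ Uxy) /nbhs_ballP[e /= e0 eU].
  have e20 : 0 < e / 2 by rewrite divr_gt0.
  have [n _ ne] := near_infty_natSinv_lt (PosNum e20).
  have n0 : 0 < n.+1%:R^-1 :> R by rewrite invr_gt0.
  have {}ne : n.+1%:R^-1 < e / 2 := ne n (leqnn n).
  have /rat_in_itvoo[p] : x < x + n.+1%:R^-1 by rewrite ltrDl.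
  rewrite in_itv /= => /andP[px1 px2].
  have /rat_in_itvoo[r] : y < y + n.+1%:R^-1 by rewrite ltrDl.
  rewrite in_itv /= => /andP[ry1 ry2].
  exists (p, r, n) => //=; rewrite asboolT /box /ball /=; move: n0 ne px2 ry2;
    move: (n.+1%:R^-1 : R) => d n0 ne px2 ry2.
    by split; rewrite /= ltr_norml; apply/andP; split; lra.
  move=> [z w] [/=]; rewrite !ltr_norml => /andP[? ?] /andP[? ?].
  by apply: eU; split; rewrite /ball /= ltr_norml; apply/andP; split; lra.
apply: countable_bigcupT_measurable => // a; case: ifP => // _.
by apply: measurableX; apply: open_measurable; exact: ball_open.
Qed.

Lemma continuous_measurable_fun2 (f : R * R -> R) :
  continuous f -> measurable_fun setT f.
Proof.
move=> /continuousP cf; apply: (measurability _ (RGenOpens.measurableE R)).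
move=> _ [_ [a [b ->] <-]]; rewrite setTI; apply: open_measurable2.
exact/cf/interval_open.
Qed.

(** Fundamental theorem of calculus for [F ^+ 2]. Integrating the absolute value over the whole of
    [a, b] makes the bound independent of the order of [x] and [y], and of the points themselves. *)
Lemma sqr_le_sqr_add_integral (F F' : R -> R) (a b x y : R) :
  (forall t, is_derive t (1 : R) F (F' t)) -> continuous F' ->
  x \in `[a, b]%R -> y \in `[a, b]%R ->
  ((F x ^+ 2)%:E <=
   (F y ^+ 2)%:E + \int[mu]_(t in `[a, b]) (2 * `|F t * F' t|)%:E)%E.
Proof.
move=> dF cF' xab yab.
have cF : continuous F.
  by move=> t; apply/differentiable_continuous/derivable1_diffP; case: (dF t).
have cG : continuous (fun t => 2 * (F t * F' t)).
  by move=> t; apply: cvgMr; apply: cvgM; [exact: cF|exact: cF'].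
have key s t : s \in `[a, b]%R -> t \in `[a, b]%R -> s < t ->
  ((F t ^+ 2 - F s ^+ 2)%:E = \int[mu]_(t in `[s, t]) (2 * (F t * F' t))%:E)%E.
  move=> sab tab st.
  have dF2 r : is_derive r (1 : R) (fun t => F t ^+ 2) (2 * (F r * F' r)).
    have := dF r => dFr; rewrite [X in is_derive _ _ X _](_ : _ = F ^+ 2)//.
    by apply: is_derive_eq; rewrite /= expr1 /GRing.scale /= mulrA mulr_natl.
  rewrite (continuous_FTC2 (F := fun t => F t ^+ 2)) ?EFinB//.
  - exact: continuous_subspaceT.
  - split=> [r _||].
    + by case: (dF2 r).
    + by apply: cvg_at_right_filter; apply: cvgM; exact: cF.
    + by apply: cvg_at_left_filter; apply: cvgM; exact: cF.
  - by move=> r _; rewrite derive1E; case: (dF2 r).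
have mG D : measurable_fun D (fun t => 2 * (F t * F' t)).
  by apply: measurable_funTS; exact: continuous_measurable_fun.
have bound s t : s \in `[a, b]%R -> t \in `[a, b]%R -> s < t ->
  (`|F t ^+ 2 - F s ^+ 2|%:E <=
     \int[mu]_(t in `[a, b]) (2 * `|F t * F' t|)%:E)%E.
  move=> sab tab st; rewrite -abse_EFin key//.
  apply: (le_trans (le_abse_integral _ _ _)) => //.
    by apply/measurable_EFinP; exact: mG.
  under eq_integral do rewrite abse_EFin normrM ger0_norm//.
  apply: ge0_subset_integral => //.
  - apply/measurable_EFinP; apply: measurable_funM => //.
    apply: measurableT_comp => //; apply: measurable_funTS.
    by apply: continuous_measurable_fun => r; apply: cvgM; [exact: cF|exact: cF'].
  - move=> r /=; move: sab tab; rewrite !in_itv /=.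
    move=> /andP[as_ _] /andP[_ tb] /andP[sr rt].
    by rewrite (le_trans as_ sr) (le_trans rt tb).
have le_abs (r s : R) (I : \bar R) : (`|r - s|%:E <= I -> r%:E <= s%:E + I)%E.
  move=> h; rewrite -leeBlDl// -EFinB; apply: le_trans h.
  by rewrite lee_fin ler_norm.
have [xy|yx|->] := ltgtP x y.
- by apply: le_abs; rewrite distrC; exact: bound.
- by apply: le_abs; exact: bound.
- by apply: leeDl; apply: integral_ge0 => r _; rewrite lee_fin mulr_ge0.
Qed.

(** The comparison point is [M], chosen beyond both [N] and [|x|]: there [F] vanishes, and [x] lies
    in [-M, M]. *)
Lemma sqr_le_integral_compact_support (F F' : R -> R) (N x : R) :
  (forall t, is_derive t (1 : R) F (F' t)) -> continuous F' ->
  (forall t, N < `|t| -> F t = 0) ->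
  ((F x ^+ 2)%:E <= \int[mu]_t (2 * `|F t * F' t|)%:E)%E.
Proof.
move=> dF cF' F0; pose M := Num.max N `|x| + 1.
have [NM xM] : N < M /\ `|x| < M.
  by split; rewrite /M ltr_pwDr// le_max lexx ?orbT.
have M0 : 0 < M by apply: le_lt_trans xM.
apply: (le_trans (sqr_le_sqr_add_integral _ _ (- M) M x M dF cF' _ _)).
- by rewrite in_itv /=; move: xM; rewrite ltr_norml => /andP[? ?]; apply/andP; split; exact: ltW.
- by rewrite in_itv /= lexx andbT; lra.
rewrite F0 ?gtr0_norm// expr0n add0e; apply: ge0_subset_integral => //.
apply/measurable_EFinP; apply: measurable_funM => //.
  apply: measurableT_comp => //.
  apply: continuous_measurable_fun => r; apply: cvgM; last exact: cF'.
  by apply/differentiable_continuous/derivable1_diffP; case: (dF r).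
Qed.

End plane.

(** * L^p norms: monotonicity, Cauchy-Schwarz, almost everywhere convergent subsequences *)

Section Lnorm.
Context d (T : measurableType d) (R : realType).
Variable mu : {measure set T -> \bar R}.
Local Open Scope ereal_scope.

Lemma le_Lnorm (p : R) (f g : T -> R) : (0 < p)%R ->
  measurable_fun setT f -> measurable_fun setT g ->
  (forall x, (`|f x| <= `|g x|)%R) ->
  'N[mu]_p%:E[EFin \o f] <= 'N[mu]_p%:E[EFin \o g].
Proof.
move=> p0 mf mg fg; rewrite unlock.
have mp (h : T -> R) : measurable_fun setT h ->
    measurable_fun setT (fun x => `|(h x)%:E| `^ p).
  move=> mh; apply: (measurableT_comp (measurable_poweR _)) => //.
  by apply: measurableT_comp => //; exact/measurable_EFinP.
have itvy (x : \bar R) : 0 <= x -> x \in Interval (BLeft 0) (BRight +oo) by rewrite in_itv/= leey andbT.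
have p_ge0 := ltW p0.
apply: gt0_ler_poweR; rewrite ?invr_ge0//.
- by apply: itvy; apply: integral_ge0 => x _; exact: poweR_ge0.
- by apply: itvy; apply: integral_ge0 => x _; exact: poweR_ge0.
apply: ge0_le_integral => //.
- by move=> x _; exact: poweR_ge0.
- exact: mp.
- exact: mp.
- move=> x _; by apply: gt0_ler_poweR => //; [apply: itvy..|rewrite lee_fin].
Qed.

Lemma Lnorm_natX (n : nat) (f : T -> R) : (0 < n)%N ->
  'N[mu]_(n%:R%:E)[EFin \o f] ^+ n = \int[mu]_x (`|f x| ^+ n)%:E.
Proof.
move=> n0; have n0R : n%:R != 0%R :> R by rewrite pnatr_eq0 -lt0n.
transitivity ('N[mu]_(n%:R%:E)[EFin \o f] `^ n%:R).
  have := @Lnorm_ge0 _ _ _ mu n%:R%:E (EFin \o f).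
  case: ('N[mu]_(n%:R%:E)[EFin \o f]) => [r|_|//]; rewrite ?lee_fin.
    by move=> r0; rewrite poweR_EFin powR_mulrn// EFin_expe.
  rewrite poweRyr//; case: n n0 {n0R} => // n _.
  by elim: n => [|n IHn]; rewrite expeS ?expe0 ?mule1// IHn mulyy.
rewrite poweR_Lnorm//; apply: eq_integral => x _ /=.
by rewrite powR_mulrn.
Qed.

Lemma Lnorm2_sqr (f : T -> R) :
  'N[mu]_2%:E[EFin \o f] ^+ 2 = \int[mu]_x (f x ^+ 2)%:E.
Proof.
rewrite (Lnorm_natX 2)//; apply: eq_integral => x _.
by rewrite real_normK// num_real.
Qed.

Lemma Lnorm2_ae0 (f : T -> R) : measurable_fun setT f ->
  {ae mu, forall x, f x = 0%R} -> 'N[mu]_2%:E[EFin \o f] = 0.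
Proof.
move=> mf f0; suff /eqP : 'N[mu]_2%:E[EFin \o f] ^+ 2 = 0.
  by rewrite expe_eq0 => /eqP.
rewrite Lnorm2_sqr -[RHS](integral0 mu setT).
apply: ae_eq_integral => //; first by apply/measurable_EFinP; exact: measurable_funX.
by apply: filterS f0 => x fx _; rewrite fx expr0n.
Qed.

Lemma integral_mul_le_Lnorm2 (f g : T -> R) :
  measurable_fun setT f -> measurable_fun setT g ->
  \int[mu]_x `|f x * g x|%:E <=
  'N[mu]_2%:E[EFin \o f] * 'N[mu]_2%:E[EFin \o g].
Proof.
move=> mf mg; have h : ((2^-1 + 2^-1)%R = 1 :> R)%R by lra.
by have := hoelder mu mf mg (ltr0Sn _ 1) (ltr0Sn _ 1) h; rewrite Lnorm1.
Qed.

(** Choose [k n >= n] with norm at most 2^-n. The squares then have integrals bounded by the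
    geometric series of ratio 1/4, so their sum is integrable, hence finite almost everywhere, and
    the terms of a convergent series tend to 0. The map [k] need not be increasing: tending to
    infinity is enough to compose limits. *)
Lemma Lnorm2_cvg0_subsequence (f : nat -> T -> R) :
  (forall n, measurable_fun setT (f n)) ->
  'N[mu]_2%:E[EFin \o f n] @[n --> \oo] --> 0 ->
  exists k : nat -> nat, [/\ k n @[n --> \oo] --> \oo%classic &
    {ae mu, forall x, (f (k n) x @[n --> \oo] --> 0)%R}].
Proof.
move=> mf f0.
have /choice[k kP] : forall n, exists k, (n <= k)%N /\
    'N[mu]_2%:E[EFin \o f k] <= ((2^-1) ^+ n)%:E.
  move=> n; have e0 : (0 < (2^-1 : R) ^+ n)%R by rewrite exprn_gt0.
  have [N _ NP] : \forall m \near \oo, 'N[mu]_2%:E[EFin \o f m] < ((2^-1) ^+ n)%:E.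
    by apply: (f0 [set y | y < ((2^-1) ^+ n)%:E]); apply: open_ereal_lt'; rewrite lte_fin.
  by exists (maxn n N); rewrite leq_maxl; split=> //; apply/ltW/NP/leq_maxr.
have mh n : measurable_fun setT (fun x => (f (k n) x ^+ 2)%:E).
  by apply/measurable_EFinP; exact: measurable_funX.
have Ih n : \int[mu]_x (f (k n) x ^+ 2)%:E <= ((4^-1) ^+ n)%:E.
  rewrite -Lnorm2_sqr; have [_ h] := kP n.
  rewrite expe2; apply: (le_trans (lee_pmul _ _ h h)); [exact: Lnorm_ge0..|].
  by rewrite -EFinM lee_fin -exprMn -invfM -natrM.
have h0 n x : 0 <= (f (k n) x ^+ 2)%:E by rewrite lee_fin sqr_ge0.
have Sfin : \int[mu]_x (\sum_(0 <= n <oo) (f (k n) x ^+ 2)%:E) < +oo.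
  rewrite integral_nneseries//.
  apply: (@le_lt_trans _ _ (1 / (1 - 4^-1))%:E); last exact: ltry.
  apply: lime_le; first by apply: is_cvg_nneseries => n _ _; exact: integral_ge0.
  apply: nearW => n.
  apply: (@le_trans _ _ (series (geometric 1 4^-1) n)%:E).
    rewrite /series /= -sumEFin; apply: lee_sum => i _.
    by rewrite mul1r; exact: Ih.
  by rewrite lee_fin geometric_le_lim// ger0_norm// invf_lt1// ltr1n.
exists k; split.
  apply/cvgnyPge => A; near=> n.
  by have [/(leq_trans _) nk _] := kP n; apply: nk; near: n; exact: nbhs_infty_ge.
have : mu.-integrable setT (fun x => \sum_(0 <= n <oo) (f (k n) x ^+ 2)%:E).
  apply/integrableP; split.
    exact: ge0_emeasurable_sum.
  by under eq_integral do rewrite gee0_abs ?nneseries_ge0//.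
move=> /(integrable_ae measurableT); apply: filterS => x /(_ I) xfin.
have : (f (k n) x ^+ 2 @[n --> \oo] --> 0)%R.
  apply: cvg_series_cvg_0; apply: nnseries_is_cvg => [i|]; first exact: sqr_ge0.
  by rewrite ltey_eq xfin.
move=> /cvgr0_norm_lt h; apply/cvgr0Pnorm_lt => e e0.
have := h _ (exprn_gt0 2 e0); apply: filterS => n.
by rewrite normrX ltr_pXn2r// nnegrE ?normr_ge0// ltW.
Unshelve. all: by end_near. Qed.

End Lnorm.

(** * Tonelli's theorem and L^2 norms on the strip *)

Section strip.
Context {R : realType}.
Local Notation mu := (@lebesgue_measure R).
Local Open Scope ereal_scope.

Lemma measurable_Omega : measurable (@Omega R).
Proof.
have -> : @Omega R = setT `*` `]0%R, 1%R[.
  by apply/seteqP; split=> -[x y] /=; rewrite in_itv/=; [|case].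
exact: measurableX.
Qed.
Hint Resolve measurable_Omega : core.

Lemma ae_lebesgue_filter : Filter (almost_everywhere mu).
Proof. exact: (ae_filter_ringOfSetsType mu). Qed.

Lemma ae_leb2_filter : Filter (almost_everywhere (@leb2 R)).
Proof. exact: (ae_filter_ringOfSetsType (mu \x mu)). Qed.

Lemma mem_Omega (x y : R) : ((x, y) \in Omega) = (y \in `]0%R, 1%R[).
Proof.
by apply/idP/idP => /set_mem xy; apply/mem_set; move: xy; rewrite /= in_itv.
Qed.

Lemma integral_restrict_Omega_vslice (F : R * R -> \bar R) (x : R) :
  \int[mu]_y (F \_ Omega) (x, y) = \int[mu]_(y in `]0%R, 1%R[) F (x, y).
Proof.
rewrite [RHS]integral_mkcond; apply: eq_integral => y _.
by rewrite !patchE mem_Omega; case: ifP.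
Qed.

Lemma measurable_integral_vslice (F : R * R -> \bar R) :
  measurable_fun setT F -> (forall q, 0 <= F q) ->
  measurable_fun setT (fun x => \int[mu]_(y in `]0%R, 1%R[) F (x, y)).
Proof.
move=> mF F0; under eq_fun do rewrite -integral_restrict_Omega_vslice.
apply: (measurable_fun_fubini_tonelli_F (m2 := mu) (F \_ Omega)).
  by apply: (proj1 (measurable_restrictT F measurable_Omega)); exact: measurable_funTS.
by move=> q; rewrite patchE; case: ifP.
Qed.

(** Both orders of integration are provided, because the vertical bound on a square depends on [x]
    alone and the horizontal one on [y] alone. *)
Lemma integral_Omega1 (F : R * R -> \bar R) :
  measurable_fun setT F -> (forall q, 0 <= F q) ->
  \int[leb2]_(q in Omega) F q = \int[mu]_x \int[mu]_(y in `]0%R, 1%R[) F (x, y).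
Proof.
move=> mF F0; rewrite integral_mkcond /leb2 fubini_tonelli1//.
- by apply: eq_integral => x _; exact: integral_restrict_Omega_vslice.
- by apply: (proj1 (measurable_restrictT F measurable_Omega)); exact: measurable_funTS.
- by move=> q; rewrite patchE; case: ifP.
Qed.

Lemma integral_Omega2 (F : R * R -> \bar R) :
  measurable_fun setT F -> (forall q, 0 <= F q) ->
  \int[leb2]_(q in Omega) F q = \int[mu]_(y in `]0%R, 1%R[) \int[mu]_x F (x, y).
Proof.
move=> mF F0; rewrite integral_mkcond /leb2 fubini_tonelli2//.
- rewrite [RHS]integral_mkcond; apply: eq_integral => y _; rewrite patchE.
  case: ifPn => [|/negbTE] y01.
    by apply: eq_integral => x _; rewrite patchE mem_Omega y01.
  by rewrite /fubini_G integral0_eq// => x _; rewrite patchE mem_Omega y01.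
- by apply: (proj1 (measurable_restrictT F measurable_Omega)); exact: measurable_funTS.
- by move=> q; rewrite patchE; case: ifP.
Qed.

Lemma LpO_natX (n : nat) (f : R * R -> R) : (0 < n)%N ->
  LpO n%:R f ^+ n = \int[leb2]_(q in Omega) (`|f q| ^+ n)%:E.
Proof.
move=> n0; rewrite /LpO Lnorm_natX// [RHS]integral_mkcond.
apply: eq_integral => q _; rewrite !patchE; case: ifP => // _.
by rewrite normr0 expr0n gtn_eqF.
Qed.

Lemma LpO_ge0 (p : R) (f : R * R -> R) : 0 <= LpO p f.
Proof. exact: Lnorm_ge0. Qed.

Lemma LpO2_sqr (f : R * R -> R) :
  LpO 2 f ^+ 2 = \int[leb2]_(q in Omega) (f q ^+ 2)%:E.
Proof.
rewrite (LpO_natX 2)//; apply: eq_integral => q _.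
by rewrite real_normK// num_real.
Qed.

Lemma LpO2D (f g : R * R -> R) :
  measurable_fun Omega f -> measurable_fun Omega g ->
  LpO 2 (fun q => f q + g q)%R <= LpO 2 f + LpO 2 g.
Proof.
move=> mf mg; rewrite /LpO.
rewrite (_ : (fun q => f q + g q)%R \_ Omega = (f \_ Omega \+ g \_ Omega)%R).
  apply: minkowski_EFin; rewrite ?ler1n//.
  - exact: (proj1 (measurable_restrictT f measurable_Omega)).
  - exact: (proj1 (measurable_restrictT g measurable_Omega)).
by apply/funext => q; rewrite /= !patchE; case: ifP => // _; rewrite addr0.
Qed.

Lemma le_LpO (p : R) (f g : R * R -> R) : (0 < p)%R ->
  measurable_fun Omega f -> measurable_fun Omega g ->
  (forall q, Omega q -> `|f q| <= `|g q|)%R -> LpO p f <= LpO p g.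
Proof.
move=> p0 mf mg fg; apply: le_Lnorm => //.
- exact: (proj1 (measurable_restrictT f measurable_Omega)).
- exact: (proj1 (measurable_restrictT g measurable_Omega)).
- by move=> q; rewrite !patchE; case: ifPn => // /set_mem; exact: fg.
Qed.

Lemma integral_mul_le_LpO2 (f g : R * R -> R) :
  measurable_fun Omega f -> measurable_fun Omega g ->
  \int[leb2]_(q in Omega) `|f q * g q|%:E <= LpO 2 f * LpO 2 g.
Proof.
move=> mf mg; rewrite integral_mkcond.
apply: le_trans; last first.
  apply: integral_mul_le_Lnorm2.
  - exact: (proj1 (measurable_restrictT f measurable_Omega)).
  - exact: (proj1 (measurable_restrictT g measurable_Omega)).
rewrite le_eqVlt; apply/orP; left; apply/eqP; apply: eq_integral => q _.
by rewrite !patchE; case: ifP => // _; rewrite mulr0 normr0.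
Qed.

End strip.

(** * The product estimate for one smooth function *)

Section core.
Context {R : realType}.
Local Notation mu := (@lebesgue_measure R).

(** The partial derivatives are explicit data and are derivatives of one-variable slices, the form
    that the fundamental theorem of calculus and differentiation under the integral consume. *)
Definition has_C1_partials (f fx fy : R * R -> R) :=
  [/\ continuous f, continuous fx, continuous fy,
      forall x y : R, is_derive x (1 : R) (fun t => f (t, y)) (fx (x, y))
    & forall x y : R, is_derive y (1 : R) (fun t => f (x, t)) (fy (x, y))].

(** What compact support in the plane gives on the strip: decay in [x] only, with arbitrary values
    on the two boundary lines. *)
Definition vanishes_far_along_x (f : R * R -> R) :=
  exists N : R, forall x y : R, N < `|x| -> f (x, y) = 0.

Lemma continuous_hslice (f : R * R -> R) (y : R) :
  continuous f -> continuous (fun x => f (x, y)).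
Proof.
move=> cf x; apply: (@continuous_comp _ _ _ (fun t => (t, y)) f); last exact: cf.
by apply: (@cvg_pair _ _ _ _ (nbhs x) (nbhs y)); [exact: cvg_id|exact: cvg_cst].
Qed.

Lemma continuous_vslice (f : R * R -> R) (x : R) :
  continuous f -> continuous (fun y => f (x, y)).
Proof.
move=> cf y; apply: (@continuous_comp _ _ _ (fun t => (x, t)) f); last exact: cf.
by apply: (@cvg_pair _ _ _ _ (nbhs x) (nbhs y)); [exact: cvg_cst|exact: cvg_id].
Qed.

(* The truncation by [b ^+ 2], rather than a term with the L^2 norm of [b] on the
   right-hand side, makes pointwise convergence of [b] to 0 enough in the limit. *)
Lemma truncated_quartic_integral_le (f fx fy : R * R -> R) (b : R -> R) :
  has_C1_partials f fx fy -> vanishes_far_along_x f ->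
  measurable_fun setT b ->
  (forall x, exists2 y : R, y \in `[0, 1]%R & f (x, y) = b x) ->
  (\int[leb2]_(q in Omega)
     (Num.max 0 (f q ^+ 2 - b q.1 ^+ 2) * f q ^+ 2)%:E
   <= 4%:E * (LpO 2 f ^+ 2 * (LpO 2 fx * LpO 2 fy)))%E.
Proof.
move=> [cf cfx cfy dfx dfy] [N fN] mb fb.
have mf := continuous_measurable_fun2 _ cf.
have mfx := continuous_measurable_fun2 _ cfx.
have mfy := continuous_measurable_fun2 _ cfy.
pose hx q := (2 * `|f q * fx q|)%:E; pose hy q := (2 * `|f q * fy q|)%:E.
have mhx : measurable_fun setT hx.
  apply/measurable_EFinP; apply: measurable_funM => //.
  by apply: measurableT_comp => //; exact: measurable_funM.
have mhy : measurable_fun setT hy.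
  apply/measurable_EFinP; apply: measurable_funM => //.
  by apply: measurableT_comp => //; exact: measurable_funM.
have hx0 q : (0 <= hx q)%E by rewrite lee_fin mulr_ge0.
have hy0 q : (0 <= hy q)%E by rewrite lee_fin mulr_ge0.
(* [A] bounds the truncated square along each vertical section, [B] the full square along each
   horizontal line. *)
pose A x := (\int[mu]_(y in `]0%R, 1%R[) hy (x, y))%E.
pose B y := (\int[mu]_x hx (x, y))%E.
have A0 x : (0 <= A x)%E by exact: integral_ge0.
have B0 y : (0 <= B y)%E by exact: integral_ge0.
have mB : measurable_fun setT B by exact: measurable_fun_fubini_tonelli_G.
have mA : measurable_fun setT A.
  exact: measurable_integral_vslice.
have fA x y : y \in `[0, 1]%R ->
    ((Num.max 0 (f (x, y) ^+ 2 - b x ^+ 2))%:E <= A x)%E.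
  move=> y01; have [z z01 <-] := fb x.
  rewrite EFin_max ge_max A0 /= EFinB leeBlDl//.
  have := sqr_le_sqr_add_integral (fun t => f (x, t)) (fun t => fy (x, t)) 0 1 y z.
  move=> /(_ (dfy x) (continuous_vslice _ _ cfy) y01 z01) /le_trans; apply.
  rewrite leeD2l// /A -(integral_itv_bndoo true false) //.
  apply: measurable_funTS; apply: (measurableT_comp mhy).
  exact: measurable_fun_pair.
have fB x y : ((f (x, y) ^+ 2)%:E <= B y)%E.
  apply: (sqr_le_integral_compact_support (fun t => f (t, y)) (fun t => fx (t, y)) N).
  - exact: continuous_hslice.
  - by move=> t; exact: fN.
pose g q := (Num.max 0 (f q ^+ 2 - b q.1 ^+ 2) * f q ^+ 2)%:E.
have g0 q : (0 <= g q)%E by rewrite lee_fin mulr_ge0 ?sqr_ge0// le_max lexx.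
have mg : measurable_fun setT g.
  apply/measurable_EFinP; apply: measurable_funM; last exact: measurable_funX.
  apply: measurable_maxr => //; apply: measurable_funB; first exact: measurable_funX.
  by apply: measurable_funX; exact: measurableT_comp.
have gslice x : measurable_fun setT (fun y => g (x, y)).
  by apply: (measurableT_comp mg); exact: measurable_fun_pair.
rewrite integral_Omega1//.
(* The majorant [A x * B y] separates variables, so its integral is a product; each factor is again
   an integral over the strip, one for each order of integration, and is bounded by
   Cauchy-Schwarz. *)
apply: (@le_trans _ _ (\int[mu]_x (A x * \int[mu]_(y in `]0%R, 1%R[) B y))%E).
  apply: ge0_le_integral => //.
  - by move=> x _; apply: integral_ge0 => y _; exact: (g0 (x, y)).
  - exact: (measurable_integral_vslice g).
  - by apply: emeasurable_funM.
  - move=> x _; rewrite -ge0_integralZl//; last exact: measurable_funTS.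
    apply: ge0_le_integral => //.
    + by move=> y _; exact: (g0 (x, y)).
    + by apply: measurable_funTS; exact: (gslice x).
    + by apply: emeasurable_funM => //; exact: measurable_funTS.
    + move=> y y01; rewrite EFinM; apply: lee_pmul => //.
      * by rewrite lee_fin le_max lexx.
      * by rewrite lee_fin sqr_ge0.
      * by apply: fA; move: y01; rewrite /= !in_itv /= => /andP[/ltW -> /ltW ->].
rewrite ge0_integralZr//; last exact: integral_ge0.
rewrite -(integral_Omega1 hy)// -(integral_Omega2 hx)//.
have hE (k : R * R -> R) : measurable_fun setT k ->
    (\int[leb2]_(q in Omega) (2 * `|f q * k q|)%:E <= 2%:E * (LpO 2 f * LpO 2 k))%E.
  move=> mk; under eq_integral do rewrite EFinM.
  rewrite ge0_integralZl//.
  - by apply: lee_wpmul2l => //; apply: integral_mul_le_LpO2; exact: measurable_funTS.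
  - exact: measurable_Omega.
  - apply/measurable_EFinP; apply: measurable_funTS.
    by apply: measurableT_comp => //; exact: measurable_funM.
apply: (le_trans (lee_pmul _ _ (hE _ mfy) (hE _ mfx))).
- by apply: integral_ge0 => q _; exact: hy0.
- by apply: integral_ge0 => q _; exact: hx0.
by rewrite muleACA -EFinM -natrM (muleACA (LpO 2 f)) -expe2 (muleC (LpO 2 fy)).
Qed.

End core.

(** * Passage to the limit in the quartic estimate *)

Section limit.
Context {R : realType}.
Local Notation mu := (@lebesgue_measure R).

(** Fatou's lemma needs pointwise convergence, which L^2 convergence of [phi] gives only along a
    subsequence [k]; the convergence of [b] is inherited by it. Since [b] tends to 0, the truncated
    integrand tends to max(0, f^2) f^2 = f^4, while the right-hand sides converge by the triangle
    inequality. *)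
Lemma integral_pow4_le_of_approximation (f fx fy : R * R -> R)
    (phi phix phiy : nat -> R * R -> R) (b : nat -> R -> R) :
  measurable_fun Omega f -> measurable_fun Omega fx -> measurable_fun Omega fy ->
  (LpO 2 f < +oo)%E -> (LpO 2 fx < +oo)%E -> (LpO 2 fy < +oo)%E ->
  (forall n, has_C1_partials (phi n) (phix n) (phiy n)) ->
  (forall n, vanishes_far_along_x (phi n)) ->
  (forall n, measurable_fun setT (b n)) ->
  (forall n x, exists2 y : R, y \in `[0, 1]%R & phi n (x, y) = b n x) ->
  LpO 2 (fun q => phi n q - f q) @[n --> \oo] --> 0%E ->
  LpO 2 (fun q => phix n q - fx q) @[n --> \oo] --> 0%E ->
  LpO 2 (fun q => phiy n q - fy q) @[n --> \oo] --> 0%E ->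
  {ae leb2, forall q, b n q.1 @[n --> \oo] --> 0} ->
  (\int[leb2]_(q in Omega) (f q ^+ 4)%:E
    <= 4%:E * (LpO 2 f ^+ 2 * (LpO 2 fx * LpO 2 fy)))%E.
Proof.
move=> mf mfx mfy f_fin fx_fin fy_fin C1phi phi0 mb phib phi_f phix_fx phiy_fy b0.
have mphi n : measurable_fun setT (phi n).
  by apply: continuous_measurable_fun2; case: (C1phi n).
have mphix n : measurable_fun setT (phix n).
  by apply: continuous_measurable_fun2; case: (C1phi n).
have mphiy n : measurable_fun setT (phiy n).
  by apply: continuous_measurable_fun2; case: (C1phi n).
have mO := @measurable_Omega R.
have [|//|k [koo phik]] := Lnorm2_cvg0_subsequence _ _ _ leb2
    (fun n => (fun q => phi n q - f q) \_ Omega).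
  move=> n; apply: (proj1 (measurable_restrictT _ mO)).
  by apply: measurable_funB => //; exact: measurable_funTS.
pose G n q := (Num.max 0 (phi (k n) q ^+ 2 - b (k n) q.1 ^+ 2) * phi (k n) q ^+ 2)%:E.
have mG n : measurable_fun Omega (G n).
  apply: measurable_funTS.
  apply/measurable_EFinP; apply: measurable_funM; last exact: measurable_funX.
  apply: measurable_maxr => //; apply: measurable_funB; first exact: measurable_funX.
  by apply: measurable_funX; exact: measurableT_comp.
have G0 n q : Omega q -> (0 <= G n q)%E.
  by move=> _; rewrite lee_fin mulr_ge0 ?sqr_ge0// le_max lexx.
have -> : (\int[leb2]_(q in Omega) (f q ^+ 4)%:E =
           \int[leb2]_(q in Omega) (limn_einf (G ^~ q)))%E.
  apply: ge0_ae_eq_integral => //.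
  - by apply/measurable_EFinP; exact: measurable_funX.
  (* Measurability of the lower limit is reduced to that of an upper limit by a change of sign. *)
  - rewrite [X in measurable_fun _ X](_ : _ =
        (fun q => - limn_esup (fun n => - G n q))%E); last first.
      apply/funext => q; rewrite -limn_einfN; congr limn_einf.
      by apply/funext => n; exact/esym/oppeK.
    apply: measurableT_comp => //; apply: measurable_fun_limn_esup => n.
    apply: measurableT_comp; [exact: oppe_measurable |exact: mG].
  - by move=> q _; rewrite lee_fin (exprM _ 2 2) sqr_ge0.
  - move=> q Oq; rewrite limn_einf_lim; apply: lime_ge; first exact: is_cvg_einfs.
    by apply: nearW => n; apply: le_ereal_inf_tmp => _ [m _ <-]; exact: G0.
  apply: filterS2 phik b0 => q phiq bq Oq.
  have {}phiq : phi (k n) q @[n --> \oo] --> f q.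
    apply/subr_cvg0; move: phiq; apply: cvg_trans; apply: near_eq_cvg.
    by apply: nearW => n; rewrite patchE mem_set.
  have {}bq : b (k n) q.1 @[n --> \oo] --> 0 := cvg_comp _ _ koo bq.
  suff Gq : G n q @[n --> \oo] --> (f q ^+ 4)%:E.
    rewrite is_cvg_limn_einfE; first by rewrite (cvg_lim _ Gq).
    by apply/cvg_ex; eexists; exact: Gq.
  apply: cvg_EFin; first exact: nearW.
  rewrite -[f q ^+ 4](_ : Num.max 0 (f q ^+ 2 - 0 ^+ 2) * f q ^+ 2 = _); last first.
    by rewrite expr0n subr0 max_r ?sqr_ge0// -exprD.
  apply: cvgM; last by apply: cvgM; exact: phiq.
  (* The maximum is rewritten with an absolute value, so that its limit follows from sums, products
     and norms. *)
  under eq_fun do rewrite maxr_absE.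
  rewrite maxr_absE; apply: cvgM; last exact: cvg_cst.
  have sqrq : phi (k n) q ^+ 2 - b (k n) q.1 ^+ 2 @[n --> \oo] --> f q ^+ 2 - 0 ^+ 2.
    by apply: cvgB; [apply: cvgM; exact: phiq|apply: cvgM; exact: bq].
  apply: cvgD; first by apply: cvgD; [exact: cvg_cst|exact: sqrq].
  by apply: cvg_norm; apply: cvgB; [exact: cvg_cst|exact: sqrq].
have /le_trans := fatou leb2 mO mG G0; apply.
pose B n : \bar R := (4%:E * ((LpO 2 f + LpO 2 (fun q => phi (k n) q - f q)%R) ^+ 2 *
  ((LpO 2 fx + LpO 2 (fun q => phix (k n) q - fx q)%R) *
   (LpO 2 fy + LpO 2 (fun q => phiy (k n) q - fy q)%R))))%E.
have GB n : (\int[leb2]_(q in Omega) G n q <= B n)%E.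
  have [N1 N2] := (C1phi (k n), phi0 (k n)).
  apply: (le_trans (truncated_quartic_integral_le _ _ _ _ N1 N2 (mb (k n)) (phib (k n)))).
  have N (h g : R * R -> R) : measurable_fun setT h -> measurable_fun Omega g ->
      (LpO 2 h <= LpO 2 g + LpO 2 (fun q => h q - g q)%R)%E.
    move=> mh mg; apply: le_trans (LpO2D _ _ mg _); last first.
      by apply: measurable_funB => //; exact: measurable_funTS.
    by rewrite le_eqVlt; apply/orP; left; apply/eqP; congr LpO;
      apply/funext => q; rewrite subrKC.
  have h1 := N _ _ (mphi (k n)) mf.
  apply: lee_wpmul2l => //; apply: lee_pmul => //.
  - by rewrite expe2 mule_ge0 ?LpO_ge0.
  - by rewrite mule_ge0 ?LpO_ge0.
  - by rewrite !expe2; apply: lee_pmul => //; exact: LpO_ge0.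
  - by apply: lee_pmul; [exact: LpO_ge0|exact: LpO_ge0|exact: N|exact: N].
(* Finiteness of the three norms excludes the indeterminate product of 0 and +oo in the extended
   reals. *)
have BC : B n @[n --> \oo] --> (4%:E * (LpO 2 f ^+ 2 * (LpO 2 fx * LpO 2 fy)))%E.
  have fin g : (LpO 2 g < +oo)%E -> LpO 2 g \is a fin_num.
    by rewrite ge0_fin_numE ?LpO_ge0.
  have cv (h : nat -> R * R -> R) g : (LpO 2 g < +oo)%E ->
      LpO 2 (fun q => h n q - g q) @[n --> \oo] --> 0%E ->
      (LpO 2 g + LpO 2 (fun q => h (k n) q - g q)%R)%E @[n --> \oo] --> LpO 2 g.
    move=> gfin hg; rewrite -[X in _ --> X]adde0; apply: cvgeD.
    - by rewrite fin_num_adde_defr// fin.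
    - exact: cvg_cst.
    - exact: (cvg_comp _ _ koo hg).
  apply: cvgeZl => //; apply: cvgeM.
  - by rewrite mule_def_fin// ?fin_numM ?fin_numX ?fin.
  - rewrite expe2; under eq_fun do rewrite expe2.
    by apply: cvgeM; [rewrite mule_def_fin// fin|exact: cv..].
  - by apply: cvgeM; [rewrite mule_def_fin// fin|exact: cv..].
have [<- _] := cvg_limn_einf_sup BC.
rewrite !limn_einf_lim; apply: lee_lim.
- exact: is_cvg_einfs.
- exact: is_cvg_einfs.
apply: nearW => n; apply: le_ereal_inf_tmp => _ [m /= nm <-].
by apply: le_trans (GB m); apply: ereal_inf_lbound; exists m.
Qed.

End limit.

(** * The vertical mean of a function on the strip *)

Section mean.
Context {R : realType}.
Local Notation mu := (@lebesgue_measure R).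

Definition vmean (F : R * R -> R) (x : R) : R := \int[mu]_(y in `[0, 1]) F (x, y).

Lemma vslice_integrable (F : R * R -> R) (x : R) : continuous F ->
  mu.-integrable `[0, 1] (EFin \o (fun y => F (x, y))).
Proof.
move=> cF; apply: continuous_compact_integrable; first exact: segment_compact.
by apply: continuous_subspaceT; exact: continuous_vslice.
Qed.

Lemma integrable_cst01 (r : R) : mu.-integrable `[0, 1] (EFin \o cst r).
Proof.
by apply: continuous_compact_integrable; [exact: segment_compact|exact: cst_continuous].
Qed.

Lemma Rintegral_cst01 (r : R) : \int[mu]_(y in `[0, 1]) r = r.
Proof.
by rewrite Rintegral_cst//= lebesgue_measure_itv/= lte_fin ltr01 oppr0 adde0 mulr1.
Qed.

(** Supplies the constant dominating function for integrals over [0, 1] that depend on the parameter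
    [x]. *)
Lemma continuous_rectangle_bound (F : R * R -> R) (a b : R) : continuous F ->
  exists2 M : R, 0 <= M &
    forall x y, x \in `[a, b]%R -> y \in `[0, 1]%R -> `|F (x, y)| <= M.
Proof.
move=> cF; have cK : compact (`[a, b] `*` `[(0 : R), 1]).
  by apply: compact_setX; exact: segment_compact.
have /compact_bounded[M [_ Mb]] : compact (F @` (`[a, b] `*` `[(0 : R), 1])).
  by apply: continuous_compact => //; exact: continuous_subspaceT.
exists (`|M| + 1) => [|x y xab y01]; first by rewrite addr_ge0.
apply: (Mb (`|M| + 1)); first by rewrite (le_lt_trans (ler_norm M))// ltrDl.
by exists (x, y).
Qed.

Lemma vmean_is_derive (f fx fy : R * R -> R) (x : R) :
  has_C1_partials f fx fy -> is_derive x (1 : R) (vmean f) (vmean fx x).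
Proof.
move=> [cf cfx _ dfx _].
have [M M0 fxM] := continuous_rectangle_bound fx (x - 1) (x + 1) cfx.
have xin : `]x - 1, x + 1[ x by rewrite /= in_itv /=; apply/andP; split; lra.
have d1E t y : partial1of2 (fun t y => f (t, y)) t y = fx (t, y).
  by rewrite partial1of2E; case: (dfx t y).
have intM := integrable_cst01 M.
have ub t y : `]x - 1, x + 1[ t -> `[0, 1] y ->
    `|partial1of2 (fun t y => f (t, y)) t y| <= M.
  move=> tx y01; rewrite d1E fxM//.
  by move: tx; rewrite /= !in_itv /= => /andP[/ltW -> /ltW ->].
have intf t : `]x - 1, x + 1[ t -> mu.-integrable `[0, 1] (EFin \o (fun y => f (t, y))).
  by move=> _; exact: vslice_integrable.
have der t y : `]x - 1, x + 1[ t -> `[0, 1] y -> derivable (fun t => f (t, y)) t 1.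
  by move=> _ _; case: (dfx t y).
have m01 : measurable (`[0, 1] : set R) by [].
apply: DeriveDef.
  exact: (derivable_under_integral (mu := mu) m01 xin intf der (fun=> M0) intM ub).
rewrite -derive1E.
rewrite (differentiation_under_integral (mu := mu) m01 xin intf der (fun=> M0) intM ub).
by apply: eq_Rintegral => y _; exact: d1E.
Qed.

Lemma continuous_vmean (F : R * R -> R) : continuous F -> continuous (vmean F).
Proof.
move=> cF x.
have [M M0 FM] := continuous_rectangle_bound F (x - 1) (x + 1) cF.
have xin : x \in (`]x - 1, x + 1[ : set R).
  by apply/mem_set; rewrite /= in_itv /=; apply/andP; split; lra.
have m01 : measurable (`[0, 1] : set R) by [].
have intM := integrable_cst01 M.
apply: (continuity_under_integral (mu := mu) (f := fun t y => F (t, y)) m01 _ _ intM _ xin).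
- by move=> t _; exact: vslice_integrable.
- by apply: aeW => y _ t _; exact: continuous_hslice.
- move=> t tx; apply: aeW => y y01; rewrite FM//.
  by move: tx; rewrite /= !in_itv /= => /andP[/ltW -> /ltW ->].
Qed.

(** The mean lies between the extreme values of the slice, so the intermediate value theorem applies
    between a minimiser and a maximiser. This makes the mean an admissible [b] in the quartic
    estimate. *)
Lemma vmean_attained (F : R * R -> R) (x : R) : continuous F ->
  exists2 y : R, y \in `[0, 1]%R & F (x, y) = vmean F x.
Proof.
move=> cF; have cs := continuous_vslice F x cF.
have iF := vslice_integrable F x cF.
have cw : {within `[0, 1], continuous (fun y => F (x, y))} by exact: continuous_subspaceT.
have [c c01 cmax] := EVT_max (@ler01 R) cw.
have [d d01 dmin] := EVT_min (@ler01 R) cw.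
have mc : vmean F x <= F (x, c).
  by rewrite -[leRHS]Rintegral_cst01; apply: le_Rintegral => //; exact: integrable_cst01.
have md : F (x, d) <= vmean F x.
  by rewrite -[leLHS]Rintegral_cst01; apply: le_Rintegral => //; exact: integrable_cst01.
have sub (a b t : R) : a \in `[0, 1]%R -> b \in `[0, 1]%R -> t \in `[a, b]%R -> t \in `[0, 1]%R.
  rewrite !in_itv /= => /andP[a0 _] /andP[_ b1] /andP[at_ tb].
  by rewrite (le_trans a0 at_) (le_trans tb b1).
have [cd|dc] := leP c d.
  have [//||y ycd Fy] := @IVT _ (fun y => F (x, y)) c d (vmean F x) cd.
  - exact: continuous_subspaceT.
  - by rewrite ge_min le_max mc md !orbT.
  - by exists y => //; exact: (sub c d).
have [//||y ycd Fy] := @IVT _ (fun y => F (x, y)) d c (vmean F x) (ltW dc).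
- exact: continuous_subspaceT.
- by rewrite ge_min le_max mc md !orbT.
- by exists y => //; exact: (sub d c).
Qed.

(** Jensen's inequality on an interval of length 1: with [c] the mean, integrate F^2 >= 2 c F - c^2,
    whose right-hand side has integral 2 c^2 - c^2 = c^2. *)
Lemma sqr_vmean_le (F : R * R -> R) (x : R) : continuous F ->
  ((vmean F x ^+ 2)%:E <= \int[mu]_(y in `]0%R, 1%R[) (F (x, y) ^+ 2)%:E)%E.
Proof.
move=> cF; have cs := continuous_vslice F x cF.
set c := vmean F x.
have iF := vslice_integrable F x cF.
have cF2 : continuous (fun q => F q ^+ 2) by move=> q; apply: cvgM; exact: cF.
have iF2 := vslice_integrable _ x cF2.
have iF2c : mu.-integrable `[0, 1] (EFin \o (fun y => 2 * c * F (x, y))).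
  apply: (vslice_integrable (fun q => 2 * c * F q)).
  by move=> q; apply: cvgM; [exact: cvg_cst|exact: cF].
rewrite -(integral_itv_bndoo true false); last first.
  apply/measurable_EFinP; apply: measurable_funTS.
  by apply: continuous_measurable_fun; exact: continuous_vslice cF2.
rewrite -[leRHS]fineK; last exact: integrable_fin_num iF2.
rewrite lee_fin.
apply: (@le_trans _ _ (\int[mu]_(y in `[0, 1]) (2 * c * F (x, y) - c ^+ 2))).
  rewrite RintegralB//; last exact: integrable_cst01.
  by rewrite RintegralZl// Rintegral_cst01 -/(vmean F x) -/c; nra.
apply: le_Rintegral => //.
  apply: (vslice_integrable (fun q => 2 * c * F q - c ^+ 2)) => q.
  apply: cvgB; last exact: cvg_cst.
  by apply: cvgM; [exact: cvg_cst|exact: cF].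
by move=> y _; have := sqr_ge0 (F (x, y) - c); nra.
Qed.

Lemma Lnorm_vmean_le (F : R * R -> R) : continuous F ->
  ('N[mu]_2%:E[EFin \o vmean F] <= LpO 2 F)%E.
Proof.
move=> cF; have mF := continuous_measurable_fun2 _ cF.
apply: lee_sqrE; first exact: LpO_ge0.
rewrite Lnorm2_sqr LpO2_sqr (integral_Omega1 (fun q => (F q ^+ 2)%:E)).
- apply: ge0_le_integral => //.
  + by move=> x _; rewrite lee_fin sqr_ge0.
  + apply/measurable_EFinP; apply: measurable_funX.
    by apply: continuous_measurable_fun; exact: continuous_vmean.
  + apply: (measurable_integral_vslice (fun q => (F q ^+ 2)%:E)) => [|q].
      by apply/measurable_EFinP; exact: measurable_funX.
    by rewrite lee_fin sqr_ge0.
  + by move=> x _; exact: sqr_vmean_le.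
- by apply/measurable_EFinP; exact: measurable_funX.
- by move=> q; rewrite lee_fin sqr_ge0.
Qed.

(** The mean inherits from [f] its vanishing for large [|x|]. The two factors play different roles:
    the first only has to stay bounded, the norm of [vmean fx] is the one that will tend to 0. *)
Lemma vmean_sqr_le (f fx fy : R * R -> R) (x : R) :
  has_C1_partials f fx fy -> vanishes_far_along_x f ->
  ((vmean f x ^+ 2)%:E <=
   2%:E * (LpO 2 f * 'N[mu]_2%:E[EFin \o vmean fx]))%E.
Proof.
move=> C1f [N fN]; have [cf cfx _ _ _] := C1f.
have der y : is_derive y (1 : R) (vmean f) (vmean fx y) by exact: vmean_is_derive C1f.
have cm := continuous_vmean fx cfx.
have mm : measurable_fun setT (vmean f).
  by apply: continuous_measurable_fun; exact: continuous_vmean.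
have mmx : measurable_fun setT (vmean fx) by exact: continuous_measurable_fun.
apply: (le_trans (sqr_le_integral_compact_support (vmean f) (vmean fx) N x der cm _)).
  move=> t Nt; rewrite /vmean -[RHS]Rintegral_cst01.
  by apply: eq_Rintegral => y _; exact: fN.
under eq_integral do rewrite EFinM.
rewrite ge0_integralZl//; last first.
  apply/measurable_EFinP; apply: measurableT_comp => //; exact: measurable_funM.
apply: lee_wpmul2l => //.
apply: (le_trans (integral_mul_le_Lnorm2 _ _ _ mu _ _ mm mmx)).
by apply: lee_wpmul2r; [exact: Lnorm_ge0|exact: Lnorm_vmean_le].
Qed.

End mean.

(** * Control of the mean of the horizontal derivative by the divergence *)

Section divergence.
Context {R : realType}.
Local Notation mu := (@lebesgue_measure R).

Lemma continuous_interpolation_derivative (p px py p' px' py' : R * R -> R) :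
  has_C1_partials p px py -> has_C1_partials p' px' py' ->
  continuous (fun q => py q + q.2 * (py' q - py q) + (p' q - p q)).
Proof.
move=> [cp _ cpy _ _] [cp' _ cpy' _ _] q.
apply: cvgD; last by apply: cvgB; [exact: cp'|exact: cp].
apply: cvgD; first exact: cpy.
apply: cvgM; first exact: cvg_snd.
by apply: cvgB; [exact: cpy'|exact: cpy].
Qed.

(* The integrand is the vertical derivative of the interpolation
   [(1 - q.2) * p q + q.2 * p' q], which has the boundary values of [p] at the
   bottom and of [p'] at the top. *)
Lemma vmean_vertical_derivative (p px py p' px' py' : R * R -> R) (x : R) :
  has_C1_partials p px py -> has_C1_partials p' px' py' ->
  vmean (fun q => py q + q.2 * (py' q - py q) + (p' q - p q)) x =
  p' (x, 1) - p (x, 0).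
Proof.
move=> C1p C1p'; have [_ _ _ _ dpy] := C1p; have [_ _ _ _ dpy'] := C1p'.
pose G y := p (x, y) + y * (p' (x, y) - p (x, y)).
pose g (q : R * R) := py q + q.2 * (py' q - py q) + (p' q - p q).
have cg : continuous g by exact: continuous_interpolation_derivative C1p C1p'.
have dG y : is_derive y (1 : R) G (g (x, y)).
  have := dpy x y; have := dpy' x y => d1 d2.
  have d3 := is_deriveB d1 d2.
  have d4 := is_deriveM (is_derive_id y (1 : R)) d3.
  apply: is_derive_eq (is_deriveD d2 d4) _.
  by rewrite /g /= !fctE /GRing.scale /=; ring.
have cG : continuous G.
  by move=> y; apply/differentiable_continuous/derivable1_diffP; case: (dG y).
rewrite /vmean /Rintegral (continuous_FTC2 (F := G)) //.
- by rewrite /= /G; ring.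
- by apply: continuous_subspaceT; exact: (continuous_vslice g).
- split=> [r _||].
  + by case: (dG r).
  + by apply: cvg_at_right_filter; exact: cG.
  + by apply: cvg_at_left_filter; exact: cG.
- by move=> r _; rewrite derive1E; case: (dG r).
Qed.

(** Complete [fx] to an approximate divergence by adding the vertical derivative of the
    interpolation between [p] and [p']. The mean of the added term is p'(x, 1) - p(x, 0), so the
    correction costs only the trace of each approximant on the line where it is small. *)
Lemma Lnorm_vmean_dx_le (f fx fy p px py p' px' py' : R * R -> R) :
  has_C1_partials f fx fy ->
  has_C1_partials p px py -> has_C1_partials p' px' py' ->
  ('N[mu]_2%:E[EFin \o vmean fx] <=
   LpO 2 (fun q => (fx q + (py q + q.2 * (py' q - py q) + (p' q - p q)))%R) +
   ('N[mu]_2%:E[EFin \o (fun x => p' (x, 1%R))] +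
    'N[mu]_2%:E[EFin \o (fun x => p (x, 0%R))]))%E.
Proof.
move=> [_ cfx _ _ _] C1p C1p'.
have [cp _ cpy _ _] := C1p; have [cp' _ cpy' _ _] := C1p'.
pose g (q : R * R) := py q + q.2 * (py' q - py q) + (p' q - p q).
have cg : continuous g by exact: continuous_interpolation_derivative C1p C1p'.
have cD : continuous (fun q => fx q + g q).
  by move=> q; apply: cvgD; [exact: cfx|exact: cg].
have mslice (h : R * R -> R) y : continuous h -> measurable_fun setT (fun x => h (x, y)).
  by move=> ch; apply: continuous_measurable_fun; exact: continuous_hslice.
have mv (h : R * R -> R) : continuous h -> measurable_fun setT (vmean h).
  by move=> ch; apply: continuous_measurable_fun; exact: continuous_vmean.
have -> : vmean fx = (vmean (fun q => fx q + g q) \+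
    (fun x => - p' (x, 1)) \+ (fun x => p (x, 0)))%R.
  apply/funext => x /=; rewrite [X in X + _ + _](_ : _ = vmean fx x + vmean g x).
    by rewrite /g (vmean_vertical_derivative _ _ _ _ _ _ x C1p C1p'); ring.
  by rewrite /vmean RintegralD//; exact: vslice_integrable.
rewrite addeA; apply: le_trans (minkowski_EFin _ _ _ _) _.
- apply: measurable_funD; first exact: mv.
  by apply: measurableT_comp => //; exact: mslice.
- exact: mslice.
- by rewrite ler1n.
rewrite leeD2r//; apply: le_trans (minkowski_EFin _ _ _ _) _.
- exact: mv.
- by apply: measurableT_comp => //; exact: mslice.
- by rewrite ler1n.
apply: leeD; first exact: Lnorm_vmean_le.
apply: le_Lnorm => //; last by move=> x; rewrite normrN.
- by apply: measurableT_comp => //; exact: mslice.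
- exact: mslice.
Qed.

End divergence.

(** * Vanishing of the mean in the limit *)

Section divergence_limit.
Context {R : realType}.
Local Notation mu := (@lebesgue_measure R).

Lemma LpO_ae0 (f : R * R -> R) : measurable_fun Omega f ->
  {ae leb2, forall q, Omega q -> f q = 0} -> LpO 2 f = 0%E.
Proof.
move=> mf f0; apply: Lnorm2_ae0.
  exact: (proj1 (measurable_restrictT f measurable_Omega)).
have FF := @ae_leb2_filter R.
by apply: filterS f0 => q fq; rewrite patchE; case: ifPn => // /set_mem.
Qed.

(** Both [psi] and [psi'] approximate the same [g], so their difference is a sum of two errors, and
    the weights 1 - y and y, which sum to 1, let the defect be compared with fx + gy = 0. *)
Lemma divergence_defect_le (fx g gy phix psi psiy psi' psiy' : R * R -> R) :
  measurable_fun Omega fx -> measurable_fun Omega g -> measurable_fun Omega gy ->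
  measurable_fun Omega phix ->
  measurable_fun Omega psi -> measurable_fun Omega psiy ->
  measurable_fun Omega psi' -> measurable_fun Omega psiy' ->
  {ae leb2, forall q, Omega q -> fx q + gy q = 0} ->
  (LpO 2 (fun q => (phix q +
     (psiy q + q.2 * (psiy' q - psiy q) + (psi' q - psi q)))%R) <=
   LpO 2 (fun q => (phix q - fx q)%R) + (LpO 2 (fun q => (psiy q - gy q)%R) +
    (LpO 2 (fun q => (psiy' q - gy q)%R) + (LpO 2 (fun q => (psi' q - g q)%R) +
     LpO 2 (fun q => (psi q - g q)%R)))))%E.
Proof.
move=> mfx mg mgy mphix mpsi mpsiy mpsi' mpsiy' fg0.
have msnd : measurable_fun Omega (fun q : R * R => q.2).
  by apply: measurable_funTS; exact: measurable_snd.
have mfg : measurable_fun Omega (fun q => fx q + gy q) by exact: measurable_funD.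
have mB (a b : R * R -> R) : measurable_fun Omega a -> measurable_fun Omega b ->
    measurable_fun Omega (fun q => a q - b q) by move=> *; exact: measurable_funB.
have mD (a b : R * R -> R) : measurable_fun Omega a -> measurable_fun Omega b ->
    measurable_fun Omega (fun q => a q + b q) by move=> *; exact: measurable_funD.
have mM (a b : R * R -> R) : measurable_fun Omega a -> measurable_fun Omega b ->
    measurable_fun Omega (fun q => a q * b q) by move=> *; exact: measurable_funM.
have m1 : measurable_fun Omega (fun q : R * R => 1 - q.2).
  by apply: (mB (cst 1)) => //; exact: measurable_cst.
have mN : measurable_fun Omega (fun q => - (psi q - g q)).
  by apply: measurableT_comp => //; exact: mB.
(* Each summand but the last is an approximation error, up to a sign or a weight that lies in [0, 1]
   on the strip; the last is the divergence of the limit, null almost everywhere. *)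
rewrite [X in LpO 2 X](_ : _ = (fun q => (phix q - fx q) +
    ((1 - q.2) * (psiy q - gy q) + (q.2 * (psiy' q - gy q) + ((psi' q - g q) +
      (- (psi q - g q) + (fx q + gy q))))))); last first.
  by apply/funext => q; ring.
apply: (le_trans (LpO2D (fun q => phix q - fx q) _ _ _)).
- exact: mB.
- by do 4 (apply: (mD) => //; try by [exact: mB|apply: (mM) => //; exact: mB]).
apply: leeD2l; apply: (le_trans (LpO2D (fun q => (1 - q.2) * (psiy q - gy q)) _ _ _)).
- by apply: (mM) => //; exact: mB.
- by do 3 (apply: (mD) => //; try by [exact: mB|apply: (mM) => //; exact: mB]).
apply: leeD.
  apply: le_LpO => //; [by apply: (mM) => //; exact: mB|exact: mB|].
  move=> q /andP[q0 q1]; rewrite normrM ler_piMl// ler_norml; apply/andP; split; lra.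
apply: (le_trans (LpO2D (fun q => q.2 * (psiy' q - gy q)) _ _ _)).
- by apply: (mM) => //; exact: mB.
- by do 2 (apply: (mD) => //; try by [exact: mB]).
apply: leeD.
  apply: le_LpO => //; [by apply: (mM) => //; exact: mB|exact: mB|].
  move=> q /andP[q0 q1]; rewrite normrM ler_piMl// ler_norml; apply/andP; split; lra.
apply: (le_trans (LpO2D (fun q => psi' q - g q) _ _ _)).
- exact: mB.
- exact: mD.
apply: leeD2l; apply: (le_trans (LpO2D (fun q => - (psi q - g q)) _ _ _)) => //.
rewrite (LpO_ae0 (fun q => fx q + gy q))// adde0.
by apply: le_LpO => //; [exact: mB|move=> q _; rewrite normrN].
Qed.

(** Here [f] and [g] stand for the two velocity components; [psi] has small values at the bottom and
    [psi'] at the top. The bound [B n] on the square of the mean does not depend on [x], so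
    convergence holds at every [x] and no subsequence is extracted. *)
Lemma vmean_cvg0 (f fx g gy : R * R -> R)
    (phi phix phiy psi psix psiy psi' psix' psiy' : nat -> R * R -> R) :
  measurable_fun Omega f -> (LpO 2 f < +oo)%E ->
  measurable_fun Omega fx -> measurable_fun Omega g -> measurable_fun Omega gy ->
  {ae leb2, forall q, Omega q -> fx q + gy q = 0} ->
  (forall n, has_C1_partials (phi n) (phix n) (phiy n)) ->
  (forall n, vanishes_far_along_x (phi n)) ->
  (forall n, has_C1_partials (psi n) (psix n) (psiy n)) ->
  (forall n, has_C1_partials (psi' n) (psix' n) (psiy' n)) ->
  LpO 2 (fun q => phi n q - f q) @[n --> \oo] --> 0%E ->
  LpO 2 (fun q => phix n q - fx q) @[n --> \oo] --> 0%E ->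
  LpO 2 (fun q => psi n q - g q) @[n --> \oo] --> 0%E ->
  LpO 2 (fun q => psiy n q - gy q) @[n --> \oo] --> 0%E ->
  LpO 2 (fun q => psi' n q - g q) @[n --> \oo] --> 0%E ->
  LpO 2 (fun q => psiy' n q - gy q) @[n --> \oo] --> 0%E ->
  ('N[mu]_2%:E[EFin \o (fun x => psi n (x, 0%R))])%E @[n --> \oo] --> 0%E ->
  ('N[mu]_2%:E[EFin \o (fun x => psi' n (x, 1%R))])%E @[n --> \oo] --> 0%E ->
  forall x, vmean (phi n) x @[n --> \oo] --> 0.
Proof.
move=> mf f_fin mfx mg mgy div0 C1phi phi0 C1psi C1psi' phi_f phix_fx psi_g
  psiy_gy psi'_g psiy'_gy tr0 tr1 x.
have mphi n : measurable_fun Omega (phi n).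
  by apply: measurable_funTS; apply: continuous_measurable_fun2; case: (C1phi n).
have mphix n : measurable_fun Omega (phix n).
  by apply: measurable_funTS; apply: continuous_measurable_fun2; case: (C1phi n).
have mpsi n : measurable_fun Omega (psi n).
  by apply: measurable_funTS; apply: continuous_measurable_fun2; case: (C1psi n).
have mpsiy n : measurable_fun Omega (psiy n).
  by apply: measurable_funTS; apply: continuous_measurable_fun2; case: (C1psi n).
have mpsi' n : measurable_fun Omega (psi' n).
  by apply: measurable_funTS; apply: continuous_measurable_fun2; case: (C1psi' n).
have mpsiy' n : measurable_fun Omega (psiy' n).
  by apply: measurable_funTS; apply: continuous_measurable_fun2; case: (C1psi' n).
pose B n := (2%:E * ((LpO 2 f + LpO 2 (fun q => (phi n q - f q)%R)) *
  ((LpO 2 (fun q => (phix n q - fx q)%R) + (LpO 2 (fun q => (psiy n q - gy q)%R) +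
    (LpO 2 (fun q => (psiy' n q - gy q)%R) + (LpO 2 (fun q => (psi' n q - g q)%R) +
     LpO 2 (fun q => (psi n q - g q)%R))))) +
  ('N[mu]_2%:E[EFin \o (fun x => psi' n (x, 1%R))] +
   'N[mu]_2%:E[EFin \o (fun x => psi n (x, 0%R))]))))%E.
have mB n : ((vmean (phi n) x ^+ 2)%:E <= B n)%E.
  apply: (le_trans (vmean_sqr_le _ _ _ x (C1phi n) (phi0 n))).
  apply: lee_wpmul2l => //; apply: lee_pmul; [exact: LpO_ge0|exact: Lnorm_ge0| |].
    apply: le_trans (LpO2D _ _ mf _); last exact: measurable_funB.
    by rewrite le_eqVlt; apply/orP; left; apply/eqP; congr LpO;
      apply/funext => q; rewrite subrKC.
  apply: (le_trans (Lnorm_vmean_dx_le _ _ _ _ _ _ _ _ _ (C1phi n) (C1psi n) (C1psi' n))).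
  by apply: leeD2r; exact: divergence_defect_le.
have B0 : B n @[n --> \oo] --> 0%E.
  have cD (a b : nat -> \bar R) : a n @[n --> \oo] --> 0%E -> b n @[n --> \oo] --> 0%E ->
      (a n + b n)%E @[n --> \oo] --> 0%E.
    by move=> a0 b0; rewrite -[X in _ --> X]adde0; apply: cvgeD; [by rewrite fin_num_adde_defr|exact: a0|exact: b0].
  have fin : LpO 2 f \is a fin_num by rewrite ge0_fin_numE ?LpO_ge0.
  rewrite -(mule0 2%:E); apply: cvgeZl => //.
  rewrite -(mule0 (LpO 2 f + 0)%E); apply: cvgeM.
  - by rewrite adde0 mule_def_fin.
  - apply: cvgeD => //; [by rewrite fin_num_adde_defr|exact: cvg_cst].
  - by do !apply: (cD).
have sq0 : vmean (phi n) x ^+ 2 @[n --> \oo] --> 0.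
  apply/(@fine_cvg _ _ _ _ (fun n => (vmean (phi n) x ^+ 2)%:E)).
  apply: (squeeze_cvge _ (cvg_cst 0%E) B0).
  by apply: nearW => n; rewrite mB lee_fin sqr_ge0.
move/cvgr0_norm_lt : sq0 => h; apply/cvgr0Pnorm_lt => e e0.
have := h _ (exprn_gt0 2 e0); apply: filterS => n.
by rewrite normrX ltr_pXn2r// nnegrE ?normr_ge0// ltW.
Qed.

End divergence_limit.

(** * From traces to smooth approximants, and the estimate for each component *)

Section traces.
Context {R : realType}.
Local Notation mu := (@lebesgue_measure R).

(** The difference quotient along a basis vector and that of the corresponding slice are the same
    function of the increment. *)
Lemma smooth_has_C1_partials (phi : R * R -> R) : smooth phi ->
  has_C1_partials phi (partial 0 phi) (partial 1 phi).
Proof.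
move=> sphi; have [cphi dphi] := sphi [::].
have [b0 b1] : Defs.basis 0 = (1, 0) :> R * R /\ Defs.basis 1 = (0, 1) :> R * R by [].
have [cx _] := sphi [:: 0]; have [cy _] := sphi [:: 1].
split; [exact: cphi|exact: cx|exact: cy|move=> x y|move=> x y].
  have hE : (fun h : R => h^-1 *: (phi (h *: (1, 0) + (x, y)) - phi (x, y))) =
            (fun h : R => h^-1 *: (phi (h *: 1 + x, y) - phi (x, y))).
    apply/funext => h; congr (_ *: (phi _ - _)).
    by rewrite [LHS]surjective_pairing /= scaler0 add0r.
  have := dphi 0 (x, y); rewrite /derivable b0 hE => d.
  by apply: DeriveDef => //; rewrite /partial /derive b0 hE.
have hE : (fun h : R => h^-1 *: (phi (h *: (0, 1) + (x, y)) - phi (x, y))) =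
          (fun h : R => h^-1 *: (phi (x, h *: 1 + y) - phi (x, y))).
  apply/funext => h; congr (_ *: (phi _ - _)).
  by rewrite [LHS]surjective_pairing /= scaler0 add0r.
have := dphi 1 (x, y); rewrite /derivable b1 hE => d.
by apply: DeriveDef => //; rewrite /partial /derive b1 hE.
Qed.

Lemma compactly_supported_vanishes (A : set (R * R)) (phi : R * R -> R) :
  compactly_supported_in A phi -> vanishes_far_along_x phi.
Proof.
move=> [K [/compact_bounded[M [_ KM]] _ phi0]].
exists (`|M| + 1) => x y xM; apply: phi0 => Kxy.
have : `|(x, y)| <= `|M| + 1.
  by apply: KM => //; rewrite (le_lt_trans (ler_norm M))// ltrDl.
rewrite leNgt => /negP; apply; apply: (lt_le_trans xM).
by rewrite prod_normE /= le_max lexx.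
Qed.

(** Membership in [H1] makes the set of weak derivatives inhabited, so the choice in [wpartial] is a
    genuine weak derivative and not the default 0. *)
Lemma wpartial_L2 (i : 'I_2) (f : R * R -> R) : H1 f -> L2 (wpartial i f).
Proof.
move=> [_ /(_ i) [g fg]].
have : is_weak_partial i f (wpartial i f) by apply: xgetPex; exists g.
by case.
Qed.

Lemma wgradE (v : R * R -> 'cV[R]_2) (q : R * R) (i j : 'I_2) :
  wgrad v q i j = wpartial j (fun q' => v q' i 0) q.
Proof. by rewrite /wgrad mxE. Qed.

Lemma mxtrace2 (A : 'M[R]_2) : \tr A = A 0 0 + A 1 1.
Proof.
rewrite /mxtrace !big_ord_recl big_ord0 addr0; congr (_ + A _ _);
  exact/val_inj.
Qed.

(** The cylinder over a null set is null, by the convention 0 * +oo = 0 in the product measure. *)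
Lemma ae_fst (P : set R) : {ae mu, forall x, P x} -> {ae leb2, forall q, P q.1}.
Proof.
move=> [A [mA A0 PA]]; exists (A `*` setT); split.
- exact: measurableX.
- by rewrite /leb2 product_measure1E// [X in (X * _)%E]A0 mul0e.
- by move=> q nPq; split=> //; exact: PA.
Qed.

(** The normal is vertical, so impermeability says that the trace of the second component is 0
    almost everywhere; convergence of the boundary values to that trace becomes convergence to 0.
    The sequence depends on the line [b]. *)
Lemma normal_trace_approximation (b : bool) (v : R * R -> 'cV[R]_2) : V v ->
  exists psi : nat -> R * R -> R,
    [/\ forall n, test_function [set: R * R] (psi n),
        LpO 2 (fun q => psi n q - v q 1 0) @[n --> \oo] --> 0%E,
        forall i, LpO 2 (fun q => partial i (psi n) q - wpartial i (fun q => v q 1 0) q)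
          @[n --> \oo] --> 0%E
      & ('N[mu]_2%:E[EFin \o (fun x => psi n (x, height b))])%E @[n --> \oo] --> 0%E].
Proof.
move=> [_ _ /(_ b)[g /(_ 1 0)[mg [psi [tpsi psi_v dpsi_v psi_g]]] gn]].
exists psi; split=> //.
have g0 : {ae mu, forall x, g x 1 0 = 0}.
  have FF := @ae_lebesgue_filter R; apply: filterS gn => x.
  rewrite /dot !big_ord_recl big_ord0 !mxE /= mulr0 add0r addr0.
  rewrite (_ : lift ord0 ord0 = 1 :> 'I_2); last exact/val_inj.
  by case: (b) => /eqP; rewrite ?mulr1 ?mulrN1 ?oppr_eq0 => /eqP.
have mpsi n : measurable_fun setT (fun x => psi n (x, height b)).
  apply: continuous_measurable_fun; apply: continuous_hslice.
  by case: (tpsi n) => /smooth_has_C1_partials[].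
apply: (squeeze_cvge _ (cvg_cst 0%E) psi_g); apply: nearW => n.
rewrite Lnorm_ge0 /=; have -> : (fun x => psi n (x, height b)) =
    (fun x => psi n (x, height b) - g x 1 0) \+ (fun x => g x 1 0).
  by apply/funext => x /=; rewrite subrK.
apply: le_trans (minkowski_EFin _ _ _ _) _; [|exact: mg|by rewrite ler1n|].
  by apply: measurable_funB; [exact: mpsi|exact: mg].
by rewrite (Lnorm2_ae0 _ _ _ mu _ mg g0) adde0.
Qed.

Lemma L4_normal_component (v : R * R -> 'cV[R]_2) : V v ->
  (\int[leb2]_(q in Omega) (v q 1 0 ^+ 4)%R%:E <=
   4%:E * (LpO 2 (fun q => v q 1 0)%R ^+ 2 *
    (LpO 2 (wpartial 0%R (fun q => v q 1 0)%R) * LpO 2 (wpartial 1%R (fun q => v q 1 0)%R))))%E.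
Proof.
move=> Vv; have [psi [tpsi psi_v dpsi_v psi0]] := normal_trace_approximation false v Vv.
have [/(_ 1) H1v _ _] := Vv.
have [mv v_fin] := H1v.1.
have [mv0 v0_fin] := wpartial_L2 0 _ H1v.
have [mv1 v1_fin] := wpartial_L2 1 _ H1v.
have mpsi n : measurable_fun setT (fun x => psi n (x, height false)).
  apply: continuous_measurable_fun; apply: continuous_hslice.
  by case: (tpsi n) => /smooth_has_C1_partials[].
(* The boundary values tend to 0 in L^2 of the line, but the limit lemma asks for pointwise
   convergence of [b], whence this subsequence. *)
have [k [koo psik0]] := Lnorm2_cvg0_subsequence _ _ _ mu
  (fun n x => psi n (x, height false)) mpsi psi0.
apply: (integral_pow4_le_of_approximation _ _ _ (fun n => psi (k n))
  (fun n => partial 0 (psi (k n))) (fun n => partial 1 (psi (k n)))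
  (fun n x => psi (k n) (x, height false))) => //.
- by move=> n; apply: smooth_has_C1_partials; case: (tpsi (k n)).
- by move=> n; apply: (compactly_supported_vanishes setT); case: (tpsi (k n)).
- by move=> n x; exists (height false) => //; rewrite /height in_itv /= lexx ler01.
- exact: (cvg_comp _ _ koo psi_v).
- exact: (cvg_comp _ _ koo (dpsi_v 0)).
- exact: (cvg_comp _ _ koo (dpsi_v 1)).
- exact: (ae_fst (fun x => psi (k n) (x, height false) @[n --> \oo] --> 0)).
Qed.

Lemma L4_tangential_component (v : R * R -> 'cV[R]_2) : V v ->
  (\int[leb2]_(q in Omega) (v q 0 0 ^+ 4)%R%:E <=
   4%:E * (LpO 2 (fun q => v q 0 0)%R ^+ 2 *
    (LpO 2 (wpartial 0%R (fun q => v q 0 0)%R) * LpO 2 (wpartial 1%R (fun q => v q 0 0)%R))))%E.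
Proof.
move=> Vv; have [H1v div0 tr] := Vv.
(* The trace of the first component serves as the source of smooth functions that converge to it
   together with their partial derivatives. *)
have [g /(_ 0 0)[_ [phi [tphi phi_v dphi_v _]]] _] := tr false.
have [psi [tpsi psi_v dpsi_v psi0]] := normal_trace_approximation false v Vv.
have [psi' [tpsi' psi'_v dpsi'_v psi'0]] := normal_trace_approximation true v Vv.
have [mv v_fin] := (H1v 0).1.
have [mv0 v0_fin] := wpartial_L2 0 _ (H1v 0).
have [mv1 v1_fin] := wpartial_L2 1 _ (H1v 0).
have [mw _] := (H1v 1).1.
have [mw1 _] := wpartial_L2 1 _ (H1v 1).
have C1 (p : R * R -> R) : test_function setT p -> has_C1_partials p (partial 0 p) (partial 1 p).
  by move=> [sp _]; exact: smooth_has_C1_partials.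
have van (p : R * R -> R) : test_function setT p -> vanishes_far_along_x p.
  by case=> _; exact: compactly_supported_vanishes.
have div0' : {ae leb2, forall q, Omega q ->
    wpartial 0 (fun q => v q 0 0) q + wpartial 1 (fun q => v q 1 0) q = 0}.
  have FF := @ae_leb2_filter R.
  by apply: filterS div0 => q /[apply]; rewrite mxtrace2 !wgradE.
have m0 := vmean_cvg0 _ _ _ _ _ _ _ _ _ _ _ _ _ mv v_fin mv0 mw mw1 div0'
  (fun n => C1 _ (tphi n)) (fun n => van _ (tphi n))
  (fun n => C1 _ (tpsi n)) (fun n => C1 _ (tpsi' n))
  phi_v (dphi_v 0) psi_v (dpsi_v 1) psi'_v (dpsi'_v 1) psi0 psi'0.
apply: (integral_pow4_le_of_approximation _ _ _ phi (fun n => partial 0 (phi n))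
  (fun n => partial 1 (phi n)) (fun n => vmean (phi n))) => //.
- by move=> n; exact: C1.
- by move=> n; exact: van.
- move=> n; apply: continuous_measurable_fun; apply: continuous_vmean.
  by case: (C1 _ (tphi n)).
- by move=> n x; apply: vmean_attained; case: (C1 _ (tphi n)).
- by apply: (ae_fst (fun x => vmean (phi n) x @[n --> \oo] --> 0)); exact: aeW.
Qed.

End traces.

(** * Comparison of entries with the Frobenius norm, and the conclusion *)

Section frobenius.
Context {R : realType}.

Lemma entry_le_frobenius m n (A : 'M[R]_(m, n)) i j : `|A i j| <= frobenius A.
Proof.
rewrite -sqrtr_sqr /frobenius ler_sqrt; last first.
  by do 2 (apply: sumr_ge0 => ? _); exact: sqr_ge0.
rewrite (bigD1 i)//= (bigD1 j)//= -addrA lerDl addr_ge0//.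
  by apply: sumr_ge0 => ? _; exact: sqr_ge0.
by do 2 (apply: sumr_ge0 => ? _); exact: sqr_ge0.
Qed.

Lemma measurable_frobenius m n (F : R * R -> 'M[R]_(m, n)) :
  (forall i j, measurable_fun Omega (fun q => F q i j)) ->
  measurable_fun Omega (fun q => frobenius (F q)).
Proof.
move=> mF; rewrite /frobenius.
apply: (@measurableT_comp _ _ _ _ _ _ (@Num.sqrt R)).
  by apply: continuous_measurable_fun; exact: sqrt_continuous.
apply: measurable_sum => i; apply: measurable_sum => j.
exact: measurable_funX.
Qed.

Lemma LpO_entry_le m n (F : R * R -> 'M[R]_(m, n)) i j :
  (forall i j, measurable_fun Omega (fun q => F q i j)) ->
  (LpO 2 (fun q => F q i j) <= LpOM 2 F)%E.
Proof.
move=> mF; apply: le_LpO => //; first exact: measurable_frobenius.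
move=> q _; rewrite (ger0_norm (sqrtr_ge0 _)); exact: entry_le_frobenius.
Qed.

End frobenius.

Theorem corollary3p6 (R : realType) (mu k0 k1 : R) (mu_gt0 : 0 < mu) :
  exists C : R, 0 < C /\
    forall u : R * R -> 'cV[R]_2, W mu k0 k1 u ->
      (LpOM 4 u ^+ 2 <= C%:E * LpOM 2 u * LpOM 2 (wgrad u))%E.
Proof.
(* Origin of the 4: |u|^4 <= 2 (u1^4 + u2^4) pointwise, and each component contributes at most 4 N^2
   D^2, where [N] and [D] are the norms of [u] and of its gradient. The fourth power of the L^4 norm
   is thus at most 2 (4 + 4) N^2 D^2 = (4 N D)^2. *)
exists 4; split=> // u [Vu _ _].
have [H1u _ _] := Vu.
have mu_ i j : measurable_fun Omega (fun q => u q i j).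
  by rewrite ord1; case: (H1u i).1.
have mgrad i j : measurable_fun Omega (fun q => wgrad u q i j).
  rewrite (_ : (fun _ => _) = wpartial j (fun q => u q i 0)); last first.
    by apply/funext => q; rewrite wgradE.
  by case: (wpartial_L2 j _ (H1u i)).
have u_le i := LpO_entry_le _ _ u i 0 mu_.
have grad_le i j : (LpO 2 (wpartial j (fun q => u q i 0%R)) <= LpOM 2 (wgrad u))%E.
  apply: le_trans (LpO_entry_le _ _ (wgrad u) i j mgrad).
  rewrite le_eqVlt; apply/orP; left; apply/eqP; congr LpO.
  by apply/funext => q; rewrite wgradE.
set N := LpOM 2 u; set D := LpOM 2 (wgrad u).
have N0 : (0 <= N)%E := LpO_ge0 _ _.
have D0 : (0 <= D)%E := LpO_ge0 _ _.
have comp_le i : (4%:E * (LpO 2 (fun q => u q i 0%R) ^+ 2 *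
    (LpO 2 (wpartial 0%R (fun q => u q i 0%R)) * LpO 2 (wpartial 1%R (fun q => u q i 0%R))))
    <= 4%:E * (N ^+ 2 * D ^+ 2))%E.
  apply: lee_wpmul2l => //; rewrite !expe2; apply: lee_pmul.
  - by rewrite mule_ge0// LpO_ge0.
  - by rewrite mule_ge0// LpO_ge0.
  - by apply: lee_pmul => //; exact: LpO_ge0.
  - by apply: lee_pmul => //; exact: LpO_ge0.
have J0 := le_trans (L4_tangential_component u Vu) (comp_le 0).
have J1 := le_trans (L4_normal_component u Vu) (comp_le 1).
have m4 i : measurable_fun Omega (fun q => (2 * u q i 0 ^+ 4)%:E).
  by apply/measurable_EFinP; apply: measurable_funM => //; exact: measurable_funX.
have pos4 i q : (0 <= (2 * u q i 0%R ^+ 4)%:E)%E.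
  by rewrite lee_fin mulr_ge0// (exprM _ 2 2) sqr_ge0.
have mO := @measurable_Omega R.
(* Squaring both sides turns the left one into the integral of the fourth power. *)
apply: lee_sqrE; first by rewrite !mule_ge0.
have -> : ((LpOM 4 u ^+ 2) ^+ 2 = LpOM 4 u ^+ 4)%E.
  by rewrite !expeS !expe0 !mule1 !muleA.
rewrite /LpOM (LpO_natX 4)//.
apply: (@le_trans _ _ (\int[leb2]_(q in Omega)
    ((2 * u q 0 0 ^+ 4)%:E + (2 * u q 1 0 ^+ 4)%:E))%E).
  apply: ge0_le_integral => //.
  - apply/measurable_EFinP; apply: measurable_funX.
    by apply: measurableT_comp => //; exact: measurable_frobenius.
  - exact: (emeasurable_funD (m4 0) (m4 1)).
  - move=> q _; rewrite -EFinD lee_fin (ger0_norm (sqrtr_ge0 _)).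
    rewrite (exprM _ 2 2) sqr_sqrtr.
      rewrite !big_ord_recl !big_ord0 !addr0 (_ : lift ord0 ord0 = 1 :> 'I_2); last exact/val_inj.
      have := sqr_ge0 (u q 0 0 ^+ 2 - u q 1 0 ^+ 2); nra.
    by do 2 (apply: sumr_ge0 => ? _); exact: sqr_ge0.
have Z i : (\int[leb2]_(q in Omega) (2 * u q i 0%R ^+ 4)%:E =
    2%:E * \int[leb2]_(q in Omega) (u q i 0%R ^+ 4)%:E)%E.
  under eq_integral do rewrite EFinM.
  rewrite ge0_integralZl//.
  - by apply/measurable_EFinP; apply: measurable_funX; exact: mu_.
  - by move=> q _; rewrite lee_fin (exprM _ 2 2) sqr_ge0.
have i0 i : (0 <= \int[leb2]_(q in Omega) (u q i 0%R ^+ 4)%:E)%E.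
  by apply: integral_ge0 => q _; rewrite lee_fin (exprM _ 2 2) sqr_ge0.
rewrite ge0_integralD//; [|exact: m4|exact: m4].
rewrite !Z -ge0_muleDr//.
have -> : ((4%:E * N * D) ^+ 2 = 16%:E * (N ^+ 2 * D ^+ 2))%E.
  by rewrite !expe2 muleACA (muleACA 4%:E) -EFinM -natrM -[LHS]muleA.
apply: (le_trans (lee_wpmul2l _ (leeD J0 J1))) => //.
rewrite -ge0_muleDl// -EFinD muleA -EFinM (_ : 2 * (4 + 4) = 16 :> R)//.
by ring.
Qed.
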